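(* Let $\Omega$ be a finite set, $m\in\Delta(\Omega)$, $\lambda\in[0,1)$, and consider the irreducible Markov chain on $\Omega$ with transitions $\pi(\omega\mid\omega)=(1-\lambda)m(\omega)+\lambda$ and $\pi(\omega'\mid\omega)=(1-\lambda)m(\omega')$ for $\omega'\ne\omega$ (so $\phi(p)=m+\lambda(p-m)$). Let $r:\Omega\to\mathbb{R}$ and $\delta\in[0,1)$. Let $k\in\{1,\dots,|\Omega^-|\}$ be such that $m\in\bar{\mathcal{O}}(k)$. Then for every initial belief $p_1\in\bar{\mathcal{O}}(k)$, the payoff of the greedy strategy satisfies $\gamma(p_1)=\gamma_*(p_1)$; in particular $\sigma_*$ is optimal at every $p_1\in\bar{\mathcal{O}}(k)$.
   Context: Identify each $\omega\in\Omega$ with a unit vector of $\mathbb{R}^\Omega$ and $\Delta(\Omega)$ with the unit simplex. For $p\in\Delta(\Omega)$ let $\langle p,r\rangle=\sum_\omega p(\omega)r(\omega)$; $I=\{p:\langle p,r\rangle\ge0\}$, $J=\Delta(\Omega)\setminus I$; $\Omega^+=\{r\ge0\}$, $\Omega^-=\{r<0\}$. Order $\Omega^-=\{\omega_1,\dots,\omega_{|\Omega^-|}\}$ so that $0>r(\omega_1)\ge\dots\ge r(\omega_{|\Omega^-|})$, and set $L_k(p)=\sum_{\omega\in\Omega^+}p(\omega)r(\omega)+\sum_{i\le k}p(\omega_i)r(\omega_i)$ for $k\ge1$, and $L_0\equiv1$. Let $\bar{\mathcal{O}}(k)=\{p\in\Delta(\Omega): L_{k-1}(p)\ge0\ge L_k(p)\}$.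 $\phi(q)=qM$ with $M$ the transition matrix. $\mathcal{S}(p)$ is the set of Borel probability measures on $\Delta(\Omega)$ with mean $p$, $\mu_p$ the Dirac mass at $p$. Decision problem from $p_1$: at each stage $n$, at belief $p_n$, the advisor chooses $\mu\in\mathcal{S}(p_n)$ (possibly depending on the past), a posterior $q_n\sim\mu$ is drawn, the stage payoff is $\mathbf{1}_{\{q_n\in I\}}$, and $p_{n+1}=\phi(q_n)$. A strategy's payoff is $\mathbb{E}[(1-\delta)\sum_{n\ge1}\delta^{n-1}\mathbf{1}_{\{q_n\in I\}}]$; $V_\delta(p_1)$ is the maximal payoff; optimal means achieving it. The greedy strategy $\sigma_*$: at $p\in I$ choose $\mu_p$; at $p\in J$ choose a two-point splitting $p=a_Iq_I+a_Jq_J$ maximizing $a_I$ subject to $q_I\in I$, $q_J\in\Delta(\Omega)$, $a_I+a_J=1$, $a_I,a_J\ge0$. $\gamma(p)$ denotes the payoff of $\sigma_*$ from initial belief $p$. Let $\widehat r(p)=\max_{\mu\in\mathcal{S}(p)}\mu(\{q\in I\})$ and $\gamma_*(p_1)=(1-\delta)\sum_{n\ge1}\delta^{n-1}\widehat r(\phi^{(n-1)}(p_1))$. *)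

(* Defs.v *)
From HB Require Import structures.
From mathcomp Require Import all_boot all_order all_algebra.
From mathcomp Require Import all_classical all_reals all_analysis.
From mathcomp Require Import measurable_realfun.
Set Implicit Arguments. Unset Strict Implicit. Unset Printing Implicit Defensive.
Import Order.TTheory GRing.Theory Num.Theory.
Import numFieldNormedType.Exports.
Local Open Scope classical_set_scope.
Local Open Scope ring_scope.

Section Defs.
Variables (R : realType) (Omega : finType).

(* beliefs: points of R^Omega, coded as #|Omega|-tuples (Borel = product sigma-algebra) *)
Definition Bel := (#|Omega|).-tuple R.
Definition pw (p : Bel) (w : Omega) : R := tnth p (enum_rank w).

Definition simplex : set Bel :=
  [set p | (forall w, 0 <= pw p w) /\ \sum_w pw p w = 1].

Definition dotr (p : Bel) (r : Omega -> R) : R := \sum_w pw p w * r w.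
Definition Iset (r : Omega -> R) : set Bel := [set p | simplex p /\ 0 <= dotr p r].

Definition trans (m : Bel) (lam : R) (w w' : Omega) : R :=
  if w' == w then (1 - lam) * pw m w' + lam else (1 - lam) * pw m w'.
Definition phi (m : Bel) (lam : R) (q : Bel) : Bel :=
  [tuple \sum_w pw q w * trans m lam w (enum_val i) | i < #|Omega|].

Fixpoint nstep (m : Bel) (lam : R) (n : nat) (w w' : Omega) : R :=
  if n is n'.+1 then \sum_v nstep m lam n' w v * trans m lam v w'
  else (w == w')%:R.
Definition irreducible (m : Bel) (lam : R) :=
  forall w w', exists n, 0 < nstep m lam n w w'.

Definition neg_order (r : Omega -> R) (s : seq Omega) :=
  [/\ uniq s, (forall w, (w \in s) = (r w < 0)) & sorted (fun a b => r b <= r a) s].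

Definition Lk (r : Omega -> R) (s : seq Omega) (k : nat) (p : Bel) : R :=
  if k is 0 then 1 else
  \sum_(w | 0 <= r w) pw p w * r w + \sum_(w <- take k s) pw p w * r w.

Definition Obar (r : Omega -> R) (s : seq Omega) (k : nat) : set Bel :=
  [set p | simplex p /\ 0 <= Lk r s k.-1 p /\ Lk r s k p <= 0].

Definition Sp (p : Bel) : set (probability Bel R) :=
  [set mu | mu simplex = 1%E /\
     forall w, (\int[mu]_q (pw q w)%:E = (pw p w)%:E)%E].

(* general (history-dependent) strategies: the history is the sequence of
   past posteriors q_1 .. q_{n-1}; the current belief is p_1 or phi(q_{n-1}) *)
Definition cur (m : Bel) (lam : R) (p1 : Bel) (h : seq Bel) : Bel :=
  last p1 [seq phi m lam q | q <- h].

Definition strategy := seq Bel -> probability Bel R.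

Definition valid_strategy (m : Bel) (lam : R) (p1 : Bel) (sigma : strategy) :=
  (forall h : seq Bel, all (fun q => q \in simplex) h -> Sp (cur m lam p1 h) (sigma h)) /\
  (forall (n : nat) (A : set Bel), measurable A ->
     @measurable_fun _ _ (n.-tuple Bel) (\bar R) setT
       (fun t : n.-tuple Bel => sigma (tval t) A)).

(* W N h = expected value of (1-delta) sum_{j=1}^{N} delta^(j-1) 1_{q_{|h|+j} in I}
   after history h (iterated integrals) *)
Fixpoint Wtrunc (r : Omega -> R) (delta : R) (sigma : strategy) (N : nat) (h : seq Bel)
  : \bar R :=
  if N is N'.+1 then
    (\int[sigma h]_q (((1 - delta) * \1_(Iset r) q)%:E
                     + delta%:E * Wtrunc r delta sigma N' (rcons h q)))%E
  else 0%E.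

Definition payoff r delta (sigma : strategy) : \bar R :=
  limn (fun N => Wtrunc r delta sigma N [::]).

Definition Vdelta (r : Omega -> R) (m : Bel) (lam delta : R) (p1 : Bel) : \bar R :=
  ereal_sup [set payoff r delta sigma | sigma in valid_strategy m lam p1].

Definition splitting (r : Omega -> R) (p : Bel) (a : R) (qI qJ : Bel) :=
  [/\ 0 <= a <= 1, Iset r qI, simplex qJ &
      forall w, pw p w = a * pw qI w + (1 - a) * pw qJ w].

Definition greedy_choice (r : Omega -> R) (g : Bel -> R * Bel * Bel) :=
  forall p, (simplex `\` Iset r) p ->
    splitting r p (g p).1.1 (g p).1.2 (g p).2 /\
    forall a qI qJ, splitting r p a qI qJ -> a <= (g p).1.1.

Fixpoint Gtrunc (r : Omega -> R) (m : Bel) (lam delta : R) (g : Bel -> R * Bel * Bel)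
  (N : nat) (p : Bel) : R :=
  if N is N'.+1 then
    if `[< Iset r p >] then (1 - delta) + delta * Gtrunc r m lam delta g N' (phi m lam p)
    else
      (g p).1.1 * ((1 - delta) * \1_(Iset r) (g p).1.2
                   + delta * Gtrunc r m lam delta g N' (phi m lam (g p).1.2))
      + (1 - (g p).1.1) * ((1 - delta) * \1_(Iset r) (g p).2
                   + delta * Gtrunc r m lam delta g N' (phi m lam (g p).2))
  else 0.

Definition gamma r m lam delta g (p : Bel) : R :=
  limn (fun N => Gtrunc r m lam delta g N p).

Definition rhat (r : Omega -> R) (p : Bel) : R :=
  fine (ereal_sup [set mu (Iset r) | mu in Sp p]).

Definition gamma_star r m lam delta (p1 : Bel) : R :=
  limn (fun N => (1 - delta) *
     \sum_(0 <= n < N) delta ^+ n * rhat r (iter n (phi m lam) p1)).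

End Defs.

(* Main.v *)
(* With [tau = r(omega_k) < 0], the linear form [f q = sum_w q(w) max(0, 1 - r(w)/tau)]
   is nonnegative on the simplex and at least [1] on [I], so it bounds the
   probability of [I] under every splitting, and the sums of its values along the
   orbit of [phi] bound every strategy. On the convex set [cutset] (those [p] with
   [sum_(r > tau) p r >= 0 >= sum_(r >= tau) p r]; it contains the closed cell [k]
   and, unlike the cell, does not depend on how ties in [r] are ordered) the greedy
   weight equals [f p], and this forces [f q_I = 1] and [f q_J = 0], hence both
   posteriors stay in [cutset]; so does their image under [phi], as [m] is in it.
   Since [f] and [phi] are affine, the greedy payoff attains the bound. *)
Require Import Defs.
From HB Require Import structures.
From mathcomp Require Import all_boot all_order all_algebra.
From mathcomp Require Import all_classical all_reals all_analysis.
From mathcomp Require Import measurable_realfun ring lra.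
Set Implicit Arguments. Unset Strict Implicit. Unset Printing Implicit Defensive.
Import Order.TTheory GRing.Theory Num.Theory.
Import numFieldNormedType.Exports.
Local Open Scope classical_set_scope.
Local Open Scope ring_scope.

(** * Linear forms on beliefs and the action of [phi] on them *)

Section Belief.
Variables (R : realType) (Omega : finType).
Implicit Types (p q m : Bel R Omega) (b r : Omega -> R).

Definition mkbel (f : Omega -> R) : Bel R Omega :=
  [tuple f (enum_val i) | i < #|Omega|].

Lemma pw_mkbel f w : pw (mkbel f) w = f w.
Proof. by rewrite /pw tnth_mktuple enum_rankK. Qed.

Lemma pw_phi_sum m lam q w :
  pw (phi m lam q) w = \sum_v pw q v * trans m lam v w.
Proof. by rewrite [LHS]/pw tnth_mktuple enum_rankK. Qed.

Lemma pw_phi m lam q w :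
  pw (phi m lam q) w = (1 - lam) * pw m w * (\sum_v pw q v) + lam * pw q w.
Proof.
rewrite pw_phi_sum mulr_sumr.
rewrite [in LHS](bigD1 w)//= [in RHS](bigD1 w)//= /trans eqxx.
rewrite (eq_bigr (fun v => (1 - lam) * pw m w * pw q v)).
  by ring.
by move=> v vw; rewrite eq_sym (negbTE vw) mulrC.
Qed.

Lemma pw_phi_simplex m lam q w : simplex q ->
  pw (phi m lam q) w = (1 - lam) * pw m w + lam * pw q w.
Proof. by case=> _ q1; rewrite pw_phi q1 mulr1. Qed.

Lemma phi_simplex m lam q : 0 <= lam < 1 -> simplex m -> simplex q ->
  simplex (phi m lam q).
Proof.
move=> /andP[l0 l1] [m0 m1] [q0 q1]; split.
  by move=> w; rewrite pw_phi_simplex// addr_ge0// mulr_ge0// subr_ge0 ltW.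
under eq_bigr do rewrite pw_phi_simplex//.
by rewrite big_split/= -!mulr_sumr m1 q1 !mulr1 subrK.
Qed.

Lemma dotr_ge0 p b : simplex p -> (forall w, 0 <= b w) -> 0 <= dotr p b.
Proof. by move=> [p0 _] b0; apply: sumr_ge0 => w _; exact: mulr_ge0. Qed.

Lemma dotr_comb a p qI qJ b :
  (forall w, pw p w = a * pw qI w + (1 - a) * pw qJ w) ->
  dotr p b = a * dotr qI b + (1 - a) * dotr qJ b.
Proof.
move=> pE; rewrite /dotr !mulr_sumr -big_split/=; apply: eq_bigr => w _.
by rewrite pE; ring.
Qed.

(** Applying the transition matrix to [b] instead of to [q] is what keeps the payoff bound a linear
    form of the belief as stages are added. *)
Lemma dotr_phi m lam q b :
  dotr (phi m lam q) b = dotr q (fun w => \sum_v trans m lam w v * b v).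
Proof.
rewrite /dotr; under [RHS]eq_bigr do rewrite mulr_sumr.
rewrite exchange_big/=; apply: eq_bigr => w _.
rewrite pw_phi_sum mulr_suml.
by apply: eq_bigr => v _; rewrite mulrA.
Qed.

Lemma trans_ge0 m lam w v : 0 <= lam < 1 -> simplex m -> 0 <= trans m lam w v.
Proof.
move=> /andP[l0 l1] [m0 m1]; have l2 : 0 <= 1 - lam by rewrite subr_ge0 ltW.
by rewrite /trans; case: ifP => _; rewrite ?addr_ge0 ?mulr_ge0.
Qed.

End Belief.

(** * The cutoff form, the convex set [cutset], and the optimal splitting *)

Section Cut.
Variables (R : realType) (Omega : finType) (r : Omega -> R) (tau : R).
Hypothesis tau0 : tau < 0.
Implicit Types p q m : Bel R Omega.

(** Positive part of the affine function of [r w] that is [0] at level [tau] and [1] at level [0]: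
    the dual certificate of the knapsack problem solved by the greedy splitting. *)
Definition cutw (w : Omega) : R := Num.max 0 (1 - r w / tau).

Definition cutset : set (Bel R Omega) :=
  [set p | [/\ simplex p, 0 <= \sum_(w | tau < r w) pw p w * r w &
               \sum_(w | tau <= r w) pw p w * r w <= 0]].

Lemma cutw_ge0 w : 0 <= cutw w.
Proof. by rewrite /cutw le_max lexx. Qed.

Lemma cutw_ge w : 1 - r w / tau <= cutw w.
Proof. by rewrite /cutw le_max lexx orbT. Qed.

Let div_tau x : (x / tau <= 1) = (tau <= x).
Proof. by rewrite ler_ndivrMr// mul1r. Qed.

Lemma cutw_hi w : tau <= r w -> cutw w = 1 - r w / tau.
Proof. by move=> h; rewrite /cutw max_r// subr_ge0 div_tau. Qed.

Lemma cutw_lo w : r w <= tau -> cutw w = 0.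
Proof. by move=> h; rewrite /cutw max_l// subr_le0 ler_ndivlMr// mul1r. Qed.

Lemma cutw_lo_gt w : r w < tau -> 1 - r w / tau < cutw w.
Proof.
move=> h; rewrite cutw_lo; last exact: ltW.
by rewrite subr_lt0 ltr_ndivlMr// mul1r.
Qed.

Lemma cutw_gt0 w : tau < r w -> 0 < cutw w.
Proof. by move=> h; rewrite cutw_hi ?ltW// subr_gt0 ltr_ndivrMr// mul1r. Qed.

Lemma dotr_affine p : simplex p ->
  dotr p (fun w => 1 - r w / tau) = 1 - dotr p r / tau.
Proof.
move=> [_ p1]; rewrite /dotr -[in RHS]p1 mulr_suml -sumrB.
by apply: eq_bigr => w _; rewrite mulrBr mulr1 mulrA.
Qed.

(** The affine minorant [1 - r / tau] of [cutw] has mean [1 - dotr q r / tau], which is at least [1]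
    as [tau < 0 <= dotr q r]. *)
Lemma dotr_cutw_Iset q : Iset r q -> 1 <= dotr q cutw.
Proof.
move=> [sq q0]; apply: (@le_trans _ _ (1 - dotr q r / tau)).
  by rewrite lerBrDr gerDl mulr_ge0_le0// invr_le0 ltW.
rewrite -dotr_affine//; apply: ler_sum => w _.
by apply: ler_wpM2l; [case: sq|exact: cutw_ge].
Qed.

Lemma dotr_cutw_hi p :
  dotr p cutw = \sum_(w | tau <= r w) pw p w
                - (\sum_(w | tau <= r w) pw p w * r w) / tau.
Proof.
rewrite /dotr (bigID (fun w => tau <= r w))/= [X in _ + X]big1 ?addr0.
  rewrite mulr_suml -sumrB; apply: eq_bigr => w h.
  by rewrite cutw_hi// mulrBr mulr1 mulrA.
by move=> w; rewrite -ltNge => /ltW /cutw_lo ->; rewrite mulr0.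
Qed.

Lemma sum_pw_le1 p (P : pred Omega) : simplex p -> \sum_(w | P w) pw p w <= 1.
Proof.
move=> [p0 <-]; rewrite [leRHS](bigID P)/= lerDl.
by apply: sumr_ge0 => w _.
Qed.

(** The form is the mass of [r >= tau] minus the sum of [p r] over that set divided by [tau]. That
    quotient is nonnegative on [cutset]. *)
Lemma dotr_cutw_le1 p : cutset p -> dotr p cutw <= 1.
Proof.
move=> [sp _ h]; rewrite dotr_cutw_hi.
have /= := sum_pw_le1 (fun w => tau <= r w) sp.
have : 0 <= (\sum_(w | tau <= r w) pw p w * r w) / tau.
  by rewrite mulr_le0// invr_le0 ltW.
by lra.
Qed.

(** Equality case of [dotr_cutw_Iset]: the gap between [cutw] and its affine minorant is
    nonnegative, while its mean is [dotr q r / tau <= 0]. Hence the mean is zero, so [dotr q r = 0]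
    and [q] has no mass where [r < tau]. *)
Lemma cutset_of_Iset q : Iset r q -> dotr q cutw = 1 -> cutset q.
Proof.
move=> [sq rq0] q1.
have gap0 w : 0 <= pw q w * (cutw w - (1 - r w / tau)).
  by apply: mulr_ge0; [case: sq|rewrite subr_ge0 cutw_ge].
have gapE : \sum_w pw q w * (cutw w - (1 - r w / tau)) = dotr q r / tau.
  under eq_bigr do rewrite mulrBr.
  by rewrite sumrB -/(dotr q cutw) q1 -/(dotr q _) dotr_affine//; ring.
have /eqP gap_eq0 : \sum_w pw q w * (cutw w - (1 - r w / tau)) == 0.
  rewrite eq_le sumr_ge0 ?andbT// gapE mulr_ge0_le0// invr_le0 ltW//.
have rq : dotr q r = 0.
  move: gapE; rewrite gap_eq0 => /esym/eqP.
  by rewrite mulf_eq0 invr_eq0 (lt_eqF tau0) orbF => /eqP.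
have qlo w : r w < tau -> pw q w = 0.
  move=> h; have /eqP := psumr_eq0P (fun w _ => gap0 w) gap_eq0 (erefl : xpredT w).
  by rewrite mulf_eq0 subr_eq0 [X in _ || X]gt_eqF ?cutw_lo_gt// orbF => /eqP.
have hi : \sum_(w | tau <= r w) pw q w * r w = 0.
  rewrite -[RHS]rq /dotr [RHS](bigID (fun w => tau <= r w))/= [X in _ + X]big1 ?addr0//.
  by move=> w; rewrite -ltNge => /qlo ->; rewrite mul0r.
split => //; last by rewrite hi.
move: hi; rewrite (bigID (fun w => tau < r w))/=.
rewrite (eq_bigl (fun w => tau < r w)); last first.
  by move=> w; rewrite andbC; case: ltP => // /ltW ->.
move=> /eqP; rewrite addr_eq0 => /eqP ->; rewrite oppr_ge0.
apply: sumr_le0 => w /andP[_]; rewrite -leNgt => h.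
by apply: mulr_ge0_le0; [case: sq|apply: le_trans h (ltW tau0)].
Qed.

(** As [cutw] is positive where [r > tau], all the mass of [q] lies on [r <= tau]. The first sum
    then vanishes and the second has only nonpositive terms. *)
Lemma cutset_of_dotr0 q : simplex q -> dotr q cutw = 0 -> cutset q.
Proof.
move=> sq q0.
have qhi w : tau < r w -> pw q w = 0.
  move=> h; have t0 v : xpredT v -> 0 <= pw q v * cutw v.
    by move=> _; apply: mulr_ge0; [case: sq|exact: cutw_ge0].
  have /eqP := psumr_eq0P t0 q0 (erefl : xpredT w).
  by rewrite mulf_eq0 [X in _ || X]gt_eqF ?cutw_gt0// orbF => /eqP.
split => //; first by rewrite big1// => w /qhi ->; rewrite mul0r.
apply: sumr_le0 => w h; have [/qhi ->|h'] := ltP tau (r w); first by rewrite mul0r.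
by apply: mulr_ge0_le0; [case: sq|exact: le_trans h' (ltW tau0)].
Qed.

Lemma dotr_cutw_Iset_eq1 p : cutset p -> Iset r p -> dotr p cutw = 1.
Proof.
by move=> Tp Ip; apply: le_anti; rewrite dotr_cutw_le1// dotr_cutw_Iset.
Qed.

(** On the simplex [phi] averages [m] and [q] with weights [1 - lam] and [lam], and [cutset] is cut
    out of the simplex by linear inequalities. *)
Lemma phi_cutset m lam q : 0 <= lam < 1 -> cutset m -> cutset q ->
  cutset (phi m lam q).
Proof.
move=> l01 [sm m1 m2] [sq q1 q2]; have /andP[l0 l1] := l01.
have l2 : 0 <= 1 - lam by rewrite subr_ge0 ltW.
have E (P : pred Omega) : \sum_(w | P w) pw (phi m lam q) w * r w =
  (1 - lam) * (\sum_(w | P w) pw m w * r w) + lam * (\sum_(w | P w) pw q w * r w).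
  rewrite !mulr_sumr -big_split/=; apply: eq_bigr => w _.
  by rewrite pw_phi_simplex//; ring.
split; first exact: phi_simplex.
- by rewrite E addr_ge0// mulr_ge0.
- by rewrite E -[leRHS]addr0 lerD// mulr_ge0_le0.
Qed.

(* Fractional knapsack: [q_I] takes all the mass above the cutoff and the
   fraction [th] of the mass on the cutoff level that exhausts the budget
   (if that level has no mass, the budget is [0] and [th = 0] as [x / 0 = 0]). *)
Lemma cutset_splitting p : cutset p -> ~ Iset r p -> 0 < dotr p cutw ->
  exists qI qJ, splitting r p (dotr p cutw) qI qJ.
Proof.
move=> [sp hgt hge] nIp a0.
have [p0 p1] := sp.
set a := dotr p cutw in a0 *.
pose S := \sum_(w | tau < r w) pw p w * r w.
pose Q := \sum_(w | r w == tau) pw p w.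
have Q0 : 0 <= Q by apply: sumr_ge0.
have splitge (F : Omega -> R) : \sum_(w | tau <= r w) F w =
    \sum_(w | tau < r w) F w + \sum_(w | r w == tau) F w.
  rewrite (bigID (fun w => tau < r w))/=; congr (_ + _); apply: eq_bigl => w.
    by case: (ltgtP tau (r w)).
  by case: (ltgtP tau (r w)).
have levelE : \sum_(w | r w == tau) pw p w * r w = tau * Q.
  by rewrite mulr_sumr; apply: eq_bigr => w /eqP ->; rewrite mulrC.
have SQ : S + tau * Q <= 0 by move: hge; rewrite splitge levelE.
pose th := S / (- tau * Q).
have thQ : th * Q * - tau = S.
  (* With no mass on the cutoff level, [SQ] and [hgt] squeeze [S] to [0]. *)
  have [Qz|Qn] := eqVneq Q 0.
    by move: SQ hgt; rewrite -/S Qz; lra.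
  by rewrite /th; field; rewrite Qn lt_eqF.
have th0 : 0 <= th by rewrite divr_ge0// mulr_ge0// oppr_ge0 ltW.
have th1 : th <= 1.
  move: Q0; rewrite le_eqVlt => /orP[/eqP Qz|Qp].
    by rewrite /th -Qz mulr0 invr0 mulr0.
  by rewrite /th ler_pdivrMr ?mulr_gt0 ?oppr_gt0// mul1r; lra.
pose cf w : R := if tau < r w then 1 else if r w == tau then th else 0.
have cf0 w : 0 <= cf w by rewrite /cf; do 2 case: ifP => // _.
have cf1 w : cf w <= 1 by rewrite /cf; do 2 case: ifP => // _.
have cfE (F : Omega -> R) : \sum_w cf w * F w =
    \sum_(w | tau < r w) F w + th * \sum_(w | r w == tau) F w.
  rewrite (bigID (fun w => tau <= r w))/= [X in _ + X]big1 ?addr0; last first.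
    move=> w; rewrite -ltNge => h; rewrite /cf ltNge (ltW h)/= lt_eqF//.
    by rewrite mul0r.
  rewrite splitge mulr_sumr; congr (_ + _); apply: eq_bigr => w h; rewrite /cf.
    by rewrite h mul1r.
  by rewrite (eqP h) ltxx eqxx.
have aE : \sum_w cf w * pw p w = a.
  rewrite cfE /a dotr_cutw_hi !splitge.
  by rewrite levelE -/S -/Q -thQ; field; rewrite lt_eqF.
have rE : \sum_w cf w * (pw p w * r w) = 0.
  by rewrite cfE -/S levelE -thQ; ring.
(* If [a = 1], the discarded part [(1 - cf) p] is zero, so [p] equals [cf p]. By [rE] its mean
   payoff is [0], which puts [p] in [I]. *)
have a1 : a < 1.
  have a_le1 : a <= 1 by apply: dotr_cutw_le1; split.
  rewrite lt_neqAle a_le1 andbT; apply/eqP => a1; apply: nIp; split => //.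
  have pE : \sum_w (1 - cf w) * pw p w = 0.
    under eq_bigr do rewrite mulrBl mul1r.
    by rewrite sumrB p1 aE a1 subrr.
  have t0 w : xpredT w -> 0 <= (1 - cf w) * pw p w.
    by move=> _; rewrite mulr_ge0// subr_ge0.
  rewrite -[leLHS]rE /dotr le_eqVlt; apply/orP; left; apply/eqP.
  apply: eq_bigr => w _; have := psumr_eq0P t0 pE (erefl : xpredT w).
  by rewrite mulrBl mul1r => /subr0_eq {2}->; rewrite mulrA.
(* The selected and the remaining mass, each normalised by its total. *)
pose qI := mkbel (fun w => cf w * pw p w / a).
pose qJ := mkbel (fun w => (1 - cf w) * pw p w / (1 - a)).
have a1' : 0 < 1 - a by rewrite subr_gt0.
exists qI, qJ; split.
- by rewrite !ltW.
- split; first split.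
  + by move=> w; rewrite pw_mkbel divr_ge0 ?(ltW a0)// mulr_ge0.
  + under eq_bigr do rewrite pw_mkbel.
    by rewrite -mulr_suml aE divff// gt_eqF.
  + rewrite /dotr (eq_bigr (fun w => cf w * (pw p w * r w) / a)).
      by rewrite -mulr_suml rE mul0r.
    by move=> w _; rewrite pw_mkbel; ring.
- split.
  + by move=> w; rewrite pw_mkbel divr_ge0 ?(ltW a1')// mulr_ge0// subr_ge0.
  + under eq_bigr do rewrite pw_mkbel.
    rewrite -mulr_suml; under eq_bigr do rewrite mulrBl mul1r.
    by rewrite sumrB p1 aE divff// gt_eqF.
- move=> w; rewrite !pw_mkbel; field.
  by rewrite !gt_eqF.
Qed.

End Cut.

(** * From closed cells to [cutset] *)

(** By sortedness the first [k] states of [s] have [r >= tau] and those from the [k]-th on have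
    [r <= tau]. Passing from [L_(k-1)] to the sum over [r > tau] drops only nonpositive terms at
    level [tau]; passing from [L_k] to the sum over [r >= tau] adds only nonpositive ones. *)
Lemma Obar_cutset (R : realType) (Omega : finType) (r : Omega -> R) s k w0 :
  neg_order r s -> (1 <= k <= size s)%N ->
  Obar r s k `<=` cutset r (r (nth w0 s k.-1)).
Proof.
move=> [us sE sors]; case: k => // k /andP[_ ks] p; set tau := r _.
case=> sp /= [Lk0 Lk1]; have [p0 _] := sp.
have tau0 : tau < 0 by rewrite -sE mem_nth.
have sor : {homo nth w0 s : i j / (i < size s)%N && (j < size s)%N && (i <= j)%N >->
    r j <= r i}.
  move=> i j /andP[/andP[is_ js] ij].
  apply: (sorted_leq_nth (leT := fun a b => r b <= r a)) => //.
    by move=> y x z /= yx zy; exact: le_trans zy yx.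
have hi w : w \in take k s -> tau <= r w.
  move=> /(nthP w0)[i]; rewrite size_takel ?(ltnW ks)// => ik <-.
  by rewrite nth_take//; apply: sor; rewrite (ltn_trans ik ks) ks ltnW.
have lo w : w \in drop k s -> r w <= tau.
  move=> /(nthP w0)[i]; rewrite size_drop ltn_subRL => ik <-.
  by rewrite nth_drop; apply: sor; rewrite ks ik leq_addr.
have neg w : w \in s -> pw p w * r w <= 0.
  by rewrite sE => /ltW rw; rewrite mulr_ge0_le0.
have sumE (P : pred Omega) : (forall w, 0 <= r w -> P w) ->
  \sum_(w | P w) pw p w * r w = \sum_(w | 0 <= r w) pw p w * r w
    + \sum_(w <- s | P w) pw p w * r w.
  move=> HP; rewrite (bigID (fun w => 0 <= r w))/=; congr (_ + _).
    apply: eq_bigl => w; case: (boolP (0 <= r w)) => [/HP ->//|_].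
    by rewrite andbF.
  rewrite -[RHS]big_filter big_uniq ?filter_uniq//=; apply: eq_bigl => w.
  by rewrite mem_filter sE ltNge.
have pos : 0 <= \sum_(w | 0 <= r w) pw p w * r w.
  by apply: sumr_ge0 => w rw; rewrite mulr_ge0.
split => //.
- rewrite sumE; last by move=> w; exact: lt_le_trans.
  rewrite -(cat_take_drop k s) big_cat/= [X in _ + (_ + X)]big1_seq ?addr0; last first.
    by move=> w /andP[tw /lo]; rewrite leNgt tw.
  (* For the first cell [L_0] is the constant [1] and not a sum, so the bound comes from [pos]
     there. *)
  have Lk' : 0 <= \sum_(w | 0 <= r w) pw p w * r w +
      \sum_(w <- take k s) pw p w * r w.
    by case: (k) Lk0 => //=; rewrite take0 big_nil addr0.
  apply: le_trans Lk' _; rewrite lerD2l [leLHS](bigID (fun w => tau < r w))/=.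
  rewrite gerDl big_seq_cond; apply: sumr_le0 => w /andP[ws _].
  by apply: neg; exact: mem_take ws.
- rewrite sumE; last by move=> w; apply: le_trans; exact: ltW.
  apply: le_trans Lk1; rewrite lerD2l -[in leLHS](cat_take_drop k.+1 s) big_cat/=.
  rewrite -[leRHS]addr0 lerD//.
    rewrite [leRHS](bigID (fun w => tau <= r w))/=.
    rewrite [X in _ <= _ + X]big1_seq ?addr0// => w /andP[/negP nw].
    rewrite (take_nth w0)// mem_rcons inE => /orP[/eqP wE|/hi//].
    by case: nw; rewrite wE.
  rewrite big_seq_cond; apply: sumr_le0 => w /andP[ws _].
  by apply: neg; exact: mem_drop ws.
Qed.

(** * The greedy payoff on [cutset] *)

Section Greedy.
Variables (R : realType) (Omega : finType) (r : Omega -> R) (tau : R).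
Hypothesis tau0 : tau < 0.
Variables (m : Bel R Omega) (lam delta : R).
Hypotheses (lam01 : 0 <= lam < 1) (delta01 : 0 <= delta < 1).
Variable g : Bel R Omega -> R * Bel R Omega * Bel R Omega.
Hypothesis gP : greedy_choice r g.
Implicit Types p q : Bel R Omega.

Let c := cutw r tau.
Let T := cutset r tau.

Lemma splitting_weight_lt1 p a qI qJ :
  simplex p -> ~ Iset r p -> splitting r p a qI qJ -> a < 1.
Proof.
move=> sp nIp [/andP[_ a1] [_ qI0] _ pE].
rewrite lt_neqAle a1 andbT; apply/eqP => aE; apply: nIp; split => //.
by rewrite (dotr_comb r pE) aE subrr mul0r addr0 mul1r.
Qed.

(** The form is at least [1] at [qI] and nonnegative at [qJ], so its mean is at least [a]. *)
Lemma splitting_weight_le p a qI qJ :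
  splitting r p a qI qJ -> a <= dotr p c.
Proof.
move=> [/andP[a0 a1] IqI sqJ pE]; rewrite (dotr_comb c pE).
have h1 := dotr_cutw_Iset tau0 IqI.
have h2 : 0 <= dotr qJ c by apply: dotr_ge0 => // w; exact: cutw_ge0.
by nra.
Qed.

Lemma greedy_weight p : T p -> ~ Iset r p -> (g p).1.1 = dotr p c.
Proof.
move=> Tp nIp; have [sp _ _] := Tp; have [gS gmax] := gP (conj sp nIp).
apply: le_anti; rewrite (splitting_weight_le gS)/=.
(* The knapsack splitting divides by its weight and is available only for a positive one; otherwise
   nonnegativity of the greedy weight suffices. *)
have [c0|c0] := leP (dotr p c) 0.
  by apply: le_trans c0 _; case: gS => /andP[].
by have [qI [qJ /gmax]] := cutset_splitting tau0 Tp nIp c0.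
Qed.

(* Since [dotr _ c] is at least [1] on [I] and nonnegative, its mean can equal
   the weight of [q_I] only if it is [1] at [q_I] and [0] at [q_J]. *)
Lemma greedy_posteriors p : T p -> ~ Iset r p ->
  [/\ 0 < (g p).1.1 -> T (g p).1.2, T (g p).2 & ~ Iset r (g p).2].
Proof.
move=> Tp nIp; have [sp _ _] := Tp; have [gS _] := gP (conj sp nIp).
have a1 := splitting_weight_lt1 sp nIp gS.
have aE := greedy_weight Tp nIp.
move: gS a1 aE; set a := (g p).1.1; set qI := (g p).1.2; set qJ := (g p).2.
move=> [/andP[a0 _] IqI sqJ pE] a1; rewrite (dotr_comb c pE) => aE.
have h1 := dotr_cutw_Iset tau0 IqI; rewrite -/c in h1.
have h2 : 0 <= dotr qJ c by apply: dotr_ge0 => // w; exact: cutw_ge0.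
have qJ0 : dotr qJ c = 0 by nra.
split.
- move=> ap; apply: cutset_of_Iset => //; rewrite -/c.
  by move: aE; rewrite qJ0 mulr0 addr0 -{1}[a]mulr1 => /(mulfI (lt0r_neq0 ap)).
- exact: cutset_of_dotr0.
- by move=> /(dotr_cutw_Iset tau0); rewrite -/c qJ0 ler10.
Qed.

(** The common yardstick for all payoffs: discounted values of the cutoff form along the
    deterministic orbit of [phi]. Peeling off the first stage matches the recursions of [Gtrunc] and
    [Wtrunc]. *)
Fixpoint Fcut (N : nat) (q : Bel R Omega) : R :=
  if N is N'.+1 then (1 - delta) * dotr q c + delta * Fcut N' (phi m lam q)
  else 0.

(** Linearity lets [Fcut] be averaged over a splitting without loss; nonnegative coefficients let it
    be integrated coordinate by coordinate. *)
Lemma Fcut_linear N : simplex m ->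
  exists2 b, forall w, 0 <= b w & forall q, Fcut N q = dotr q b.
Proof.
move=> sm; have /andP[d0 d1] := delta01.
elim: N => [|N [b b0 bE]] /=.
  by exists (fun=> 0) => // q; rewrite /dotr big1// => w _; rewrite mulr0.
exists (fun w => (1 - delta) * c w + delta * \sum_v trans m lam w v * b v).
  move=> w; rewrite addr_ge0// mulr_ge0 ?subr_ge0 ?cutw_ge0 ?(ltW d1)//.
  by apply: sumr_ge0 => v _; rewrite mulr_ge0// trans_ge0.
move=> q; rewrite bE dotr_phi /dotr !mulr_sumr -big_split/=.
by apply: eq_bigr => w _; ring.
Qed.

Lemma Fcut_sum N q :
  Fcut N q = (1 - delta) * \sum_(0 <= n < N) delta ^+ n * dotr (iter n (phi m lam) q) c.
Proof.
elim: N q => [|N IH] q /=; first by rewrite big_geq// mulr0.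
rewrite IH big_nat_recl//= expr0 mul1r mulrDr; congr (_ + _).
rewrite mulrCA; congr (_ * _); rewrite mulr_sumr; apply: eq_bigr => n _.
by rewrite exprS mulrA -iterS iterSr.
Qed.

Hypothesis Tm : T m.

Lemma iter_phi_cutset n p : T p -> T (iter n (phi m lam) p).
Proof. by move=> Tp; elim: n => //= n; exact: phi_cutset. Qed.

(** The orbit stays in [cutset], where the form lies between [0] and [1]. The sums thus increase and
    are bounded by [1]. *)
Lemma is_cvg_Fcut p : T p -> cvgn (Fcut ^~ p).
Proof.
move=> Tp; have /andP[d0 d1] := delta01; have d1' : 0 < 1 - delta by rewrite subr_gt0.
have Tn n := iter_phi_cutset n Tp.
have t0 n : 0 <= dotr (iter n (phi m lam) p) c.
  by apply: dotr_ge0; [case: (Tn n)|move=> w; exact: cutw_ge0].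
apply: nondecreasing_is_cvgn.
  apply/nondecreasing_seqP => N; rewrite !Fcut_sum big_nat_recr//= mulrDr lerDl.
  by rewrite mulr_ge0 ?(ltW d1')// mulr_ge0 ?exprn_ge0.
exists 1 => _ [N _ <-]; rewrite Fcut_sum.
apply: (@le_trans _ _ ((1 - delta) * \sum_(0 <= n < N) delta ^+ n)).
  apply: ler_wpM2l; first exact: ltW.
  apply: ler_sum => n _; rewrite -[leRHS]mulr1; apply: ler_wpM2l.
    exact: exprn_ge0.
  exact: (dotr_cutw_le1 tau0 (Tn n)).
rewrite big_mkord -opprB mulNr -subrX1 opprB gerBl exprn_ge0//.
Qed.

(** The expected stage payoff equals the form at [p], being [1] on [I] and the weight of [q_I]
    elsewhere; the continuation averages out by linearity. *)
Lemma Gtrunc_cut N p : T p -> Gtrunc r m lam delta g N p = Fcut N p.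
Proof.
elim: N p => //= N IH p Tp.
case: asboolP => [Ip|nIp].
  by rewrite (dotr_cutw_Iset_eq1 tau0 Tp Ip) mulr1 IH//; exact: phi_cutset.
have aE := greedy_weight Tp nIp.
have [TI TJ nIJ] := greedy_posteriors Tp nIp.
have [sp _ _] := Tp; have [[/andP[a0 _] IqI sqJ pE] _] := gP (conj sp nIp).
have [sm _ _] := Tm; have [b b0 bE] := Fcut_linear N sm.
have -> : Fcut N (phi m lam p) = (g p).1.1 * Fcut N (phi m lam (g p).1.2)
    + (1 - (g p).1.1) * Fcut N (phi m lam (g p).2).
  by rewrite !bE !dotr_phi; exact: dotr_comb.
rewrite -aE !indicE mem_set// memNset// mulr1n mulr0n (IH (phi m lam (g p).2)); last exact: phi_cutset.
(* At weight [0] the posterior [q_I] may leave [cutset], but its term is then multiplied by zero. *)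
have [az|a1] := eqVneq (g p).1.1 0; first by rewrite az; ring.
have {a1}a0 : 0 < (g p).1.1 by rewrite lt0r a1.
by rewrite IH; [ring|apply: phi_cutset => //; exact: TI].
Qed.

End Greedy.

(* No measurability is needed: the integral of a nonnegative function is a
   supremum over the simple functions below it. *)
Lemma le_integralT d (T : measurableType d) (R : realType)
    (mu : {measure set T -> \bar R}) (f1 f2 : T -> \bar R) :
  (forall x, 0 <= f1 x)%E -> (forall x, f1 x <= f2 x)%E ->
  (\int[mu]_x f1 x <= \int[mu]_x f2 x)%E.
Proof.
move=> f10 f12; have f20 x : (0 <= f2 x)%E by exact: le_trans (f10 x) (f12 x).
rewrite !ge0_integralTE//; apply: ereal_sup_le => _ [h /= hf <-].
by exists h => //= x; exact: le_trans (hf x) (f12 x).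
Qed.

Lemma measurable_ler_set d (T : measurableType d) (R : realType) (f g : T -> R) :
  measurable_fun setT f -> measurable_fun setT g ->
  measurable [set x | f x <= g x].
Proof.
move=> mf mg; have := measurable_fun_ler mf mg measurableT (Y := [set true]).
by rewrite setTI; apply.
Qed.

(** * Two-point probability measures *)

Section TwoPoint.
Context d (T : measurableType d) (R : realType).

(** The integral formula asks for nonnegativity of [K] at the two atoms only, so that it applies to
    coordinates, which change sign off the simplex. *)
Lemma two_point_exists (a : R) (x y : T) : 0 <= a <= 1 ->
  exists mu : probability T R,
    (forall A, mu A = (a * \1_A x + (1 - a) * \1_A y)%:E) /\
    (forall K : T -> \bar R, measurable_fun setT K ->
      (0 <= K x)%E -> (0 <= K y)%E ->
      (\int[mu]_q K q = a%:E * K x + (1 - a)%:E * K y)%E).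
Proof.
move=> /andP[a0 a1]; have b0 : 0 <= 1 - a by rewrite subr_ge0.
pose nu : {measure set T -> \bar R} := measure_add (mscale (NngNum a0) (dirac x : {measure set T -> \bar R}))
  (mscale (NngNum b0) (dirac y : {measure set T -> \bar R})).
have nuE A : nu A = (a * \1_A x + (1 - a) * \1_A y)%:E.
  by rewrite [LHS]measure_addE.
have nu1 : nu setT = 1%E by rewrite nuE !indicT !mulr1 addrC subrK.
(* [nu] already has mass [1]; normalising only supplies the probability structure. *)
pose P : probability T R := mnormalize nu (dirac x : probability T R).
have PE A : P A = nu A by rewrite [LHS]/(mnormalize _ _ A) nu1 onee_eq0/= invr1 mule1.
exists P; split => [A|K mK Kx Ky]; first by rewrite PE.
have ge0 (L : T -> \bar R) : measurable_fun setT L -> (forall q, 0 <= L q)%E ->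
    (\int[nu]_q L q = a%:E * L x + (1 - a)%:E * L y)%E.
  move=> mL L0; rewrite ge0_integral_measure_add//.
  by rewrite !ge0_integral_mscale// !integral_dirac// !diracT !mul1e.
rewrite (eq_measure_integral nu); last by move=> A _ _; exact: PE.
rewrite integralE !ge0//; try exact: measurable_funepos; try exact: measurable_funeneg.
rewrite !funeposE !funenegE (max_l Kx) (max_l Ky) !max_r ?oppe_le0//.
by rewrite !mule0 adde0 sube0.
Qed.

End TwoPoint.

(** * Measurability of the simplex, of [I] and of [phi] *)

Section BeliefMeasure.
Variables (R : realType) (Omega : finType).
Local Notation Bel := (Bel R Omega).

Lemma measurable_pw w : measurable_fun [set: Bel] (fun q : Bel => pw q w).
Proof. exact: measurable_tnth. Qed.

Lemma measurable_dotr (b : Omega -> R) :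
  measurable_fun [set: Bel] (fun q : Bel => dotr q b).
Proof.
apply: measurable_sum => w; apply: measurable_funM => //; exact: measurable_pw.
Qed.

Lemma measurable_phi (m : Bel) lam : measurable_fun [set: Bel] (phi m lam).
Proof.
apply/measurable_fun_tnthP => i; rewrite /comp.
under eq_fun do rewrite tnth_mktuple.
exact: measurable_dotr.
Qed.

Lemma measurable_simplex : measurable (@simplex R Omega).
Proof.
rewrite (_ : @simplex R Omega = (\bigcap_(w in [set: Omega]) [set q : Bel | 0 <= pw q w])
   `&` [set q | \sum_w pw q w = 1]); last first.
  by apply/seteqP; split => q [q0 q1]; split => // w; [move=> _|]; exact: q0.
apply: measurableI.
  apply: fin_bigcap_measurable => // w _.
  exact: measurable_ler_set (measurable_cst (0 : R)) (measurable_pw w).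
have ms : measurable_fun [set: Bel] (fun q : Bel => \sum_w pw q w).
  by apply: measurable_sum => w; exact: measurable_pw.
rewrite (_ : mkset _ = [set q : Bel | \sum_w pw q w <= 1] `&`
                       [set q : Bel | 1 <= \sum_w pw q w]).
  by apply: measurableI; exact: measurable_ler_set.
by apply/seteqP; split => q /= => [->//|[q1 q2]]; apply: le_anti; rewrite q1.
Qed.

Lemma measurable_Iset (r : Omega -> R) : measurable (Iset r).
Proof.
rewrite (_ : Iset r = @simplex R Omega `&` [set q | 0 <= dotr q r])//.
apply: measurableI; first exact: measurable_simplex.
exact: measurable_ler_set (measurable_cst (0 : R)) (measurable_dotr r).
Qed.

End BeliefMeasure.

(** * Integral bounds over splittings and the value of [rhat] *)

Section Splittings.
Variables (R : realType) (Omega : finType).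
Implicit Types p q : Bel R Omega.

Lemma Sp_ae_simplex p (mu : probability (Bel R Omega) R) : Sp p mu ->
  {ae mu, forall q, simplex q}.
Proof.
move=> [mu1 _]; exists (~` @simplex R Omega); split => //.
  by apply: measurableC; exact: measurable_simplex.
by rewrite probability_setC ?mu1 ?subee//; exact: measurable_simplex.
Qed.

(** A splitting is carried by the simplex, and there [u] lies below a linear form whose mean is its
    value at [p]. *)
Lemma Sp_le_integral p (mu : probability (Bel R Omega) R) (b : Omega -> R)
    (u : Bel R Omega -> \bar R) : Sp p mu -> (forall w, 0 <= b w) ->
  (forall q, 0 <= u q)%E -> (forall q, simplex q -> u q <= (dotr q b)%:E)%E ->
  (\int[mu]_q u q <= (dotr p b)%:E)%E.
Proof.
move=> Spmu b0 u0 ub; have ae_sim := Sp_ae_simplex Spmu; have [mu1 muE] := Spmu.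
(* [v] dominates [u] everywhere and is infinite only on a null set. The truncated coordinates [P]
   agree with [pw] on the simplex and are nonnegative everywhere, as termwise integration
   requires. *)
pose v q : \bar R := if `[< simplex q >] then (dotr q b)%:E else +oo%E.
pose P w q : R := Num.max 0 (pw q w).
have mP w : measurable_fun setT (P w).
  by apply: measurable_maxr => //; exact: measurable_pw.
have mv : measurable_fun setT v.
  apply: measurable_fun_ifT => //.
    apply: (measurable_fun_bool true); rewrite setTI.
    rewrite (_ : _ @^-1` _ = @simplex R Omega); first exact: measurable_simplex.
    by apply/seteqP; split => q /= /asboolP.
  by apply/measurable_EFinP; exact: measurable_dotr.
apply: (@le_trans _ _ (\int[mu]_q v q)%E).
  apply: le_integralT => // q; rewrite /v; case: asboolP => [/ub//|_].
  by rewrite leey.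
have mbP w : measurable_fun setT (fun q => ((b w)%:E * (P w q)%:E)%E).
  by apply: measurable_funeM; apply/measurable_EFinP.
rewrite (@ae_eq_integral _ _ _ mu setT
  (fun q => \sum_(w <- index_enum Omega) (b w)%:E * (P w q)%:E)%E)//; last 2 first.
- exact: emeasurable_sum.
- apply: filterS ae_sim => q sq _; rewrite /v asboolT// /dotr -sumEFin.
  apply: eq_bigr => w _; rewrite -EFinM /P max_r; first by rewrite mulrC.
  by case: sq.
rewrite ge0_integral_sum//; last first.
  by move=> w q _; rewrite mule_ge0// lee_fin// le_max lexx.
rewrite /dotr -sumEFin lee_sum// => w _.
rewrite ge0_integralZl_EFin//; last 2 first.
- by move=> q _; rewrite lee_fin le_max lexx.
- by apply/measurable_EFinP.
rewrite (@ae_eq_integral _ _ _ mu setT (fun q => (pw q w)%:E))//; last 3 first.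
- by apply/measurable_EFinP.
- by apply/measurable_EFinP; exact: measurable_pw.
- by apply: filterS ae_sim => q [q0 _] _; rewrite /P max_r.
by rewrite muE -EFinM mulrC.
Qed.

Lemma two_point_Sp a p x y : 0 <= a <= 1 -> simplex x -> simplex y ->
  (forall w, pw p w = a * pw x w + (1 - a) * pw y w) ->
  forall mu : probability (Bel R Omega) R,
  (forall A, mu A = (a * \1_A x + (1 - a) * \1_A y)%:E) ->
  (forall K : Bel R Omega -> \bar R, measurable_fun setT K ->
      (0 <= K x)%E -> (0 <= K y)%E ->
      (\int[mu]_q K q = a%:E * K x + (1 - a)%:E * K y)%E) -> Sp p mu.
Proof.
move=> a01 sx sy pE mu muA muI; split.
  by rewrite muA !indicE !mem_set// !mulr1 addrC subrK.
move=> w; rewrite muI ?lee_fin.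
- by rewrite pE.
- by apply/measurable_EFinP; exact: measurable_pw.
- by case: sx.
- by case: sy.
Qed.

Variables (r : Omega -> R) (tau : R).
Hypothesis tau0 : tau < 0.
Variable g : Bel R Omega -> R * Bel R Omega * Bel R Omega.
Hypothesis gP : greedy_choice r g.

(** The form dominates the indicator of [I] on the simplex, which bounds the supremum. The Dirac
    mass on [I] and the greedy splitting elsewhere attain it. *)
Lemma rhat_cut p : cutset r tau p -> rhat r p = dotr p (cutw r tau).
Proof.
move=> Tp; have [sp _ _] := Tp.
rewrite /rhat; suff -> : ereal_sup [set (mu : probability _ R) (Iset r) | mu in Sp p]
  = (dotr p (cutw r tau))%:E by [].
apply/eqP; rewrite eq_le; apply/andP; split.
  apply: ge_ereal_sup => _ [mu Spmu <-].
  rewrite -(setIT (Iset r)) -integral_indic//; last exact: measurable_Iset.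
  apply: Sp_le_integral => //.
  - exact: cutw_ge0.
  - move=> q sq; rewrite lee_fin indicE; case: (boolP (_ \in _)) => [|_].
      by rewrite inE => /(dotr_cutw_Iset tau0).
    by apply: dotr_ge0 => //; exact: cutw_ge0.
apply: ereal_sup_ubound.
have [Ip|nIp] := pselect (Iset r p).
  have a01 : 0 <= (1 : R) <= 1 by rewrite ler01 lexx.
  have [mu [muA muI]] := two_point_exists p p a01.
  exists mu.
    by apply: (two_point_Sp a01 sp sp _ muA muI) => w; rewrite subrr mul0r addr0 mul1r.
  by rewrite muA (dotr_cutw_Iset_eq1 tau0 Tp Ip) subrr mul0r addr0 mul1r indicE (mem_set Ip).
have aE := greedy_weight tau0 gP Tp nIp.
have [_ _ nIJ] := greedy_posteriors tau0 gP Tp nIp.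
have [[a01 IqI sqJ pE] _] := gP (conj sp nIp).
have [mu [muA muI]] := two_point_exists (g p).1.2 (g p).2 a01.
exists mu; first by case: IqI => sqI _; exact: (two_point_Sp a01 sqI sqJ pE muA muI).
by rewrite muA !indicE mem_set// memNset// mulr1 mulr0 addr0 aE.
Qed.

End Splittings.

(** * Measurability under finite modifications *)

Lemma measurable_tuple_set1 d (T : measurableType d) n (t : n.-tuple T) :
  (forall x : T, measurable [set x]) -> measurable [set t].
Proof.
move=> m1; rewrite (_ : [set t] =
  \bigcap_(i in [set: 'I_n]) ((@tnth n T ^~ i) @^-1` [set tnth t i])).
  apply: fin_bigcap_measurable => // i _; rewrite -[X in measurable X]setTI.
  exact: measurable_tnth.
apply/seteqP; split => [_ -> //|u tu]; apply: eq_from_tnth => i.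
exact: (tu i).
Qed.

(** Preimages under [f] and [f0] differ only inside [D], all of whose subsets are finite and hence
    measurable. *)
Lemma measurable_fun_finite_change d d' (T : measurableType d)
    (T' : measurableType d') (f f0 : T -> T') (D : set T) :
  (forall x : T, measurable [set x]) -> finite_set D ->
  measurable_fun setT f0 -> (forall x, ~ D x -> f x = f0 x) ->
  measurable_fun setT f.
Proof.
move=> m1 finD mf0 ff0 _ Y mY; rewrite setTI.
have mfin (E : set T) : E `<=` D -> measurable E.
  move=> ED; rewrite (_ : E = \bigcup_(x in E) [set x]).
    by apply: fin_bigcup_measurable => //; exact: sub_finite_set finD.
  by apply/seteqP; split => [x Ex|x [y Ey ->]//]; exists x.
rewrite (_ : f @^-1` Y = (f0 @^-1` Y `\` D) `|` (D `&` f @^-1` Y)).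
  apply: measurableU; last by apply: mfin; exact: subIsetl.
  apply: measurableD; last exact: mfin.
  by rewrite -[X in measurable X]setTI; exact: mf0.
apply/seteqP; split => x /=.
- have [Dx|nDx] := pselect (D x); first by right.
  by rewrite ff0//; left.
- by case=> [[Yx nDx]|[]//]; rewrite ff0.
Qed.

(** * Upper bound for every strategy, and a valid strategy playing greedily *)

Section Strategies.
Variables (R : realType) (Omega : finType) (r : Omega -> R).
Variables (m : Bel R Omega) (lam delta : R).
Hypotheses (sm : simplex m) (lam01 : 0 <= lam < 1) (delta01 : 0 <= delta < 1).
Variable p1 : Bel R Omega.
Hypothesis sp1 : simplex p1.
Implicit Types (p q : Bel R Omega) (h : seq (Bel R Omega)).

Local Notation cur := (cur m lam p1).
Local Notation Wtrunc := (Wtrunc r delta).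

Let delta_ge0 : 0 <= delta. Proof. by case/andP: delta01. Qed.
Let delta_le1 : 0 <= 1 - delta.
Proof. by case/andP: delta01 => _ /ltW; rewrite subr_ge0. Qed.

Lemma cur_rcons h q : cur (rcons h q) = phi m lam q.
Proof. by rewrite /Defs.cur map_rcons last_rcons. Qed.

Lemma cur_simplex h : all (fun q => q \in @simplex R Omega) h -> simplex (cur h).
Proof.
case/lastP: h => // h q; rewrite all_rcons cur_rcons => /andP[+ _].
by rewrite inE; exact: phi_simplex.
Qed.

Lemma stage_ge0 q : 0 <= (1 - delta) * \1_(Iset r) q.
Proof. by rewrite mulr_ge0// indicE ler0n. Qed.

Lemma Wtrunc_ge0 sigma N h : (0 <= Wtrunc sigma N h)%E.
Proof.
elim: N h => //= N IH h; apply: integral_ge0 => q _.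
by rewrite adde_ge0 ?lee_fin ?stage_ge0// mule_ge0.
Qed.

Lemma Wtrunc_nondecreasing sigma h :
  nondecreasing_seq (fun N => Wtrunc sigma N h).
Proof.
apply/nondecreasing_seqP => N; elim: N h => [|N IH] h; first exact: Wtrunc_ge0.
apply: le_integralT => q.
  by rewrite adde_ge0 ?lee_fin ?stage_ge0// mule_ge0// Wtrunc_ge0.
by rewrite leeD2l// lee_wpmul2l.
Qed.

(** At each posterior the stage payoff is at most the form and, by induction, the continuation at
    most [Fcut] after [phi]. Their sum is linear in the posterior, so its mean is its value at the
    current belief. *)
Lemma Wtrunc_le_Fcut tau sigma N h : tau < 0 -> valid_strategy m lam p1 sigma ->
  all (fun q => q \in @simplex R Omega) h ->
  (Wtrunc sigma N h <= (Fcut r tau m lam delta N (cur h))%:E)%E.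
Proof.
move=> tau0 [vs _]; elim: N h => //= N IH h sh.
have [b b0 bE] := Fcut_linear r tau lam01 delta01 N.+1 sm.
rewrite -/(Fcut r tau m lam delta N.+1 (cur h)) bE.
apply: Sp_le_integral => //; first exact: vs.
- by move=> q; rewrite adde_ge0 ?lee_fin ?stage_ge0// mule_ge0// Wtrunc_ge0.
- move=> q sq; rewrite -bE /= EFinD EFinM leeD//.
    rewrite -EFinM lee_fin ler_wpM2l// indicE; case: (boolP (_ \in _)) => [|_].
      by rewrite inE => /(dotr_cutw_Iset tau0).
    by apply: dotr_ge0 => //; exact: cutw_ge0.
  rewrite EFinM lee_wpmul2l//; rewrite -(cur_rcons h); apply: IH.
  by rewrite all_rcons sh andbT inE.
Qed.

Variable g : Bel R Omega -> R * Bel R Omega * Bel R Omega.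
Hypothesis gP : greedy_choice r g.

Definition greedy_act p : R * Bel R Omega * Bel R Omega :=
  if `[< Iset r p >] then (1, p, p) else g p.

(** Both posteriors are kept even when one has weight [0], so the list is a finite superset of the
    histories of positive probability. *)
Fixpoint reach n : seq (seq (Bel R Omega)) :=
  if n is n'.+1 then
    [seq rcons h q | h <- reach n',
       q <- [:: (greedy_act (cur h)).1.2; (greedy_act (cur h)).2]]
  else [:: [::]].

(* Outside the finitely many histories of each length that the greedy strategy
   can generate, reveal nothing: this makes any greedy selection measurable. *)
Definition greedy_plan h : R * Bel R Omega * Bel R Omega :=
  if (h \in reach (size h)) && `[< simplex (cur h) >]
  then greedy_act (cur h) else (1, cur h, cur h).

Lemma greedy_act_splits p (t := greedy_act p) : simplex p ->
  [/\ 0 <= t.1.1 <= 1, simplex t.1.2, simplex t.2 &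
      forall w, pw p w = t.1.1 * pw t.1.2 w + (1 - t.1.1) * pw t.2 w].
Proof.
move=> sp; rewrite /t /greedy_act; case: asboolP => [_|nIp].
  by split => //= [|w]; rewrite ?ler01 ?lexx// subrr mul0r addr0 mul1r.
by have [[a01 [sqI _] sqJ pE] _] := gP (conj sp nIp).
Qed.

Lemma greedy_plan_weight h : 0 <= (greedy_plan h).1.1 <= 1.
Proof.
rewrite /greedy_plan; case: ifPn => [/andP[_ /asboolP /greedy_act_splits[]]//|_].
by rewrite ler01 lexx.
Qed.

Lemma Gtrunc_ge0 N p : simplex p -> 0 <= Gtrunc r m lam delta g N p.
Proof.
elim: N p => //= N IH p sp; case: asboolP => [_|nIp].
  by rewrite addr_ge0// mulr_ge0// IH//; exact: phi_simplex.
have [[/andP[a0 a1] [sqI _] sqJ pE] _] := gP (conj sp nIp).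
by rewrite addr_ge0// mulr_ge0 ?subr_ge0// addr_ge0 ?stage_ge0// mulr_ge0// IH//;
  exact: phi_simplex.
Qed.

Lemma Gtrunc_greedy_act N p (t := greedy_act p)
    (G := fun q => (1 - delta) * \1_(Iset r) q
                   + delta * Gtrunc r m lam delta g N (phi m lam q)) :
  Gtrunc r m lam delta g N.+1 p = t.1.1 * G t.1.2 + (1 - t.1.1) * G t.2.
Proof.
rewrite /t /greedy_act /G /=; case: asboolP => [Ip|//].
by rewrite /= subrr mul0r addr0 mul1r indicE mem_set// mulr1.
Qed.

Lemma measurable_cur n :
  measurable_fun setT (fun t : n.-tuple (Bel R Omega) => cur (tval t)).
Proof.
case: n => [|n].
  rewrite (_ : (fun _ => _) = cst p1)//; apply/funext => t.
  by rewrite tuple0.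
(* For a nonempty history the current belief depends on the last posterior alone. *)
rewrite (_ : (fun _ => _) = phi m lam \o (@tnth _ _ ^~ ord_max)).
  by apply: measurableT_comp; [exact: measurable_phi|exact: measurable_tnth].
apply/funext => t; rewrite /= (tnth_nth p1) /Defs.cur /=.
by case: t => -[//|q s] /= /eqP[<-]; rewrite last_map (last_nth p1).
Qed.

Lemma measurable_bel_set1 q : measurable [set q].
Proof. by apply: measurable_tuple_set1 => x; exact: measurable_set1. Qed.

Lemma greedy_strategy_exists : exists2 sigma, valid_strategy m lam p1 sigma &
  forall N, ((Gtrunc r m lam delta g N p1)%:E <= Wtrunc sigma N [::])%E.
Proof.
have /choice[sigma sigmaP] h :=
  two_point_exists (greedy_plan h).1.2 (greedy_plan h).2 (greedy_plan_weight h).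
exists sigma; first split.
- move=> h sh; have sc := cur_simplex sh; have [sA sI] := sigmaP h.
  apply: (two_point_Sp (greedy_plan_weight h) _ _ _ sA sI); rewrite /greedy_plan asboolT//;
    case: ifP => _ //=; try by have [] := greedy_act_splits sc.
  by move=> w; rewrite subrr mul0r addr0 mul1r.
- move=> n A mA.
  apply: (@measurable_fun_finite_change _ _ _ _ _
    (fun t : n.-tuple (Bel R Omega) => (\1_A (cur (tval t)))%:E)
    (@tval n (Bel R Omega) @^-1` [set` reach n])).
  + by move=> t; apply: measurable_tuple_set1; exact: measurable_bel_set1.
  + apply: finite_preimage; last exact: finite_seq.
    by move=> ? ? _ _; exact: val_inj.
  + apply/measurable_EFinP.
    apply: (@measurableT_comp _ _ _ _ _ _ (\1_A : Bel R Omega -> R) _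
      (fun t : n.-tuple (Bel R Omega) => cur (tval t))).
      exact: measurable_indic.
    exact: measurable_cur.
  + move=> t /= /negP nt; rewrite (sigmaP _).1 /greedy_plan size_tuple (negbTE nt)/=.
    by rewrite subrr mul0r addr0 mul1r.
(* Induction on the horizon needs the claim at every reachable history. *)
suff H N h : h \in reach (size h) -> simplex (cur h) ->
    ((Gtrunc r m lam delta g N (cur h))%:E <= Wtrunc sigma N h)%E.
  by move=> N; exact: (H N [::]).
elim: N h => [//|N IH] h hr sc.
pose t := greedy_act (cur h).
have tE : greedy_plan h = t by rewrite /greedy_plan hr asboolT.
have [t01 sx sy _] := greedy_act_splits sc; rewrite -/t in t01 sx sy.
pose E : set (Bel R Omega) := [set t.1.2; t.2].
pose G q := (1 - delta) * \1_(Iset r) q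
            + delta * Gtrunc r m lam delta g N (phi m lam q).
(* [K] keeps the greedy payoff at the two atoms and is zero elsewhere: it is measurable, has the
   greedy value as its integral, and lies below the integrand of [Wtrunc]. *)
pose K q : \bar R := if `[< E q >] then (G q)%:E else 0%E.
have KE q : E q -> K q = (G q)%:E by move=> Eq; rewrite /K asboolT.
have Ex : E t.1.2 by left.
have Ey : E t.2 by right.
have G0 q : simplex q -> 0 <= G q.
  by move=> sq; rewrite addr_ge0 ?stage_ge0// mulr_ge0// Gtrunc_ge0//; exact: phi_simplex.
have sE q : E q -> simplex q by case=> ->.
have K0 q : (0 <= K q)%E.
  by rewrite /K; case: asboolP => // /sE sq; rewrite lee_fin G0.
have mK : measurable_fun setT K.
  apply: (@measurable_fun_finite_change _ _ _ _ _ (cst 0%E) E) => //.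
  - exact: measurable_bel_set1.
  - by rewrite /E; exact: finite_set2.
  - by move=> q nEq; rewrite /K asboolF.
have -> : (Gtrunc r m lam delta g N.+1 (cur h))%:E = (\int[sigma h]_q K q)%E.
  have [_ ->//] := sigmaP h; rewrite tE !KE//.
  by rewrite Gtrunc_greedy_act.
rewrite [leRHS]/=; apply: le_integralT => // q.
rewrite /K; case: asboolP => [Eq|_]; last first.
  by rewrite adde_ge0 ?lee_fin ?stage_ge0// mule_ge0// Wtrunc_ge0.
rewrite /G EFinD leeD2l// EFinM lee_wpmul2l// -(cur_rcons h); apply: IH.
  rewrite size_rcons; apply/flatten_mapP; exists h => //.
  by case: Eq => ->; rewrite !inE eqxx ?orbT.
by rewrite cur_rcons; apply: phi_simplex => //; exact: sE.
Qed.

End Strategies.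

(** * Passage to the limit in the horizon *)

Theorem theorem5 (R : realType) (Omega : finType) (m : Bel R Omega) (lam : R)
  (r : Omega -> R) (delta : R) (s : seq Omega) (k : nat)
  (g : Bel R Omega -> R * Bel R Omega * Bel R Omega) :
  simplex m -> 0 <= lam < 1 -> irreducible m lam -> 0 <= delta < 1 ->
  neg_order r s -> (1 <= k <= size s)%N -> Obar r s k m ->
  greedy_choice r g ->
  forall p1 : Bel R Omega, Obar r s k p1 ->
    gamma r m lam delta g p1 = gamma_star r m lam delta p1 /\
    (gamma r m lam delta g p1)%:E = Vdelta r m lam delta p1.
Proof.
move=> sm lam01 _ delta01 ns ks Om gP p1 Op1.
have [w0 _] : exists w0 : Omega, True.
  by case: (s) ks => [|w ? _]; [case: (k)|exists w].
(* The level of [omega_k], which sits at index [k.-1] as sequences start at [0]. *)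
pose tau := r (nth w0 s k.-1).
have tau0 : tau < 0.
  have [_ sE _] := ns; rewrite -sE mem_nth//.
  by move: ks => /andP[k0 ks]; rewrite prednK.
have TO := Obar_cutset w0 ns ks; rewrite -/tau in TO.
have [Tm Tp1] := (TO _ Om, TO _ Op1); have [sp1 _ _] := Tp1.
have GF : (fun N => Gtrunc r m lam delta g N p1) = (Fcut r tau m lam delta) ^~ p1.
  by apply/funext => N; exact: Gtrunc_cut.
have cF := is_cvg_Fcut tau0 lam01 delta01 Tm Tp1.
split.
  rewrite /gamma GF; congr (lim (_ @ \oo)); apply/funext => N; rewrite Fcut_sum.
  congr (_ * _); apply: eq_bigr => n _; congr (_ * _).
  by rewrite (rhat_cut tau0 gP)//; exact: iter_phi_cutset.
have FE : (gamma r m lam delta g p1)%:E =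
    limn (fun N => (Fcut r tau m lam delta N p1)%:E).
  by rewrite /gamma GF -EFin_lim.
have cFE : cvgn (fun N => (Fcut r tau m lam delta N p1)%:E).
  move/cvg_ex : cF => [l Fl]; apply/cvg_ex; exists l%:E.
  by apply: cvg_EFin => //; exact: nearW.
have cW sigma : cvgn (fun N => Wtrunc r delta sigma N [::]).
  by apply: ereal_nondecreasing_is_cvgn; exact: Wtrunc_nondecreasing.
apply/eqP; rewrite eq_le; apply/andP; split.
  (* A valid strategy earning at least the greedy payoff at every horizon bounds the supremum from
     below; the opposite bound is [Wtrunc_le_Fcut] in the limit. *)
  have [sigma vs Gs] := greedy_strategy_exists sm lam01 delta01 sp1 gP.
  apply: (@le_trans _ _ (payoff r delta sigma)).
    rewrite FE; apply: lee_lim => //; apply: nearW => N.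
    by rewrite -(Gtrunc_cut tau0 lam01 delta01 gP Tm).
  by apply: ereal_sup_ubound; exists sigma.
apply: ge_ereal_sup => _ [sigma vs <-].
rewrite FE; apply: lee_lim => //; apply: nearW => N.
exact: (Wtrunc_le_Fcut r sm lam01 delta01 N tau0 vs (h := [::]) isT).
Qed.
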